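(* Let $A$ be a vector space over $\mathbb{C}$ equipped with a linear operator $\partial$ and a linear map $Y_-:A\to\mathrm{Hom}(A,x^{-1}A[x^{-1}])$, $a\mapsto Y_-(a,x)$, such that for all $a,b\in A$, $$[\partial,Y_-(a,x)]=\frac{d}{dx}Y_-(a,x),\qquad Y_-(a,x)b=\mathrm{Sing}\left(e^{x\partial}Y_-(b,-x)a\right).$$ Let $a,b,c\in A$. Then the half commutator formula for the ordered triple $(a,b,c)$ implies the half commutator formula for any permutation of $(a,b,c)$.
   Context: For a formal series $f(x_1,\dots,x_n)=\sum_{m_1,\dots,m_n\in\mathbb{Z}}u(m_1,\dots,m_n)x_1^{-m_1-1}\cdots x_n^{-m_n-1}$, $\mathrm{Sing} f=\sum_{m_1,\dots,m_n\ge0}u(m_1,\dots,m_n)x_1^{-m_1-1}\cdots x_n^{-m_n-1}$. The half commutator formula for an ordered triple $(a,b,c)$ is the identity $$[Y_-(a,x_1),Y_-(b,x_2)]c=\mathrm{Sing}\left(Y_-(Y_-(a,x_1-x_2)b,x_2)c\right),$$ where negative powers of $x_1-x_2$ are expanded in nonnegative powers of $x_2$. *)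

(* Defs.v *)
From HB Require Import structures.
From mathcomp Require Import all_boot all_order all_algebra.
From mathcomp Require Import boolp classical_sets functions fsbigop reals.
From mathcomp Require Import complex.

Set Implicit Arguments.
Unset Strict Implicit.
Unset Printing Implicit Defensive.

Import GRing.Theory Num.Theory.
Local Open Scope classical_set_scope.
Local Open Scope ring_scope.

(* Formal series are indexed by exponents: [f n] is the coefficient of [x^n]
   and [f i j] that of [x1^i x2^j]. The coefficient [u m] of [x^(-m-1)] is thus
   [f (-m-1)], and [m >= 0] reads [n < 0] for the exponent [n = -m-1]. *)
Notation fseries A := (int -> A).
Notation fseries2 A := (int -> int -> A).

Section FormalSeries.
Variables (F : fieldType) (A : lmodType F).

Definition Sing (f : fseries A) : fseries A :=
  fun n => if n < 0 then f n else 0.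

Definition Sing2 (f : fseries2 A) : fseries2 A :=
  fun i j => if (i < 0) && (j < 0) then f i j else 0.

(* [f] lies in x^-1 A[x^-1] *)
Definition polar (f : fseries A) : Prop :=
  (forall n : int, 0 <= n -> f n = 0) /\
  (exists N : int, forall n : int, n < N -> f n = 0).

Definition fderiv (f : fseries A) : fseries A :=
  fun n => f (n + 1) *~ (n + 1).

(* f(-x) *)
Definition fopp (f : fseries A) : fseries A :=
  fun n => ((-1 : F) ^ n) *: f n.

(* e^(x D) f(x); for [f] polar every coefficient is a finite sum. *)
Definition fexp (D : A -> A) (f : fseries A) : fseries A :=
  fun n => \sum_(k \in [set: nat]) (k`!%:R : F)^-1 *: iter k D (f (n - k%:Z)).

(* n(n-1)...(n-k+1)/k! for an arbitrary integer n *)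
Definition binz (n : int) (k : nat) : F :=
  (\prod_(i < k) (n - i%:Z)%:~R) / k`!%:R.

(* f(x1 - x2), where (x1 - x2)^n = \sum_(k >= 0) (-1)^k binz n k x1^(n-k) x2^k
   for every integer n: the monomial x1^i x2^k occurs only for n = i + k. *)
Definition fsub (f : fseries A) : fseries2 A :=
  fun i j => if j is Posz k
             then ((-1) ^+ k * binz (i + k%:Z) k) *: f (i + k%:Z)
             else 0.

Variable Y : A -> A -> fseries A.

(* Y(g(x1, x2), x2) c, with [Y] extended coefficientwise to the series g; for
   g = f(x1 - x2) with [f] polar every coefficient is a finite sum. *)
Definition app2 (g : fseries2 A) (c : A) : fseries2 A :=
  fun i j => \sum_(k \in [set: int]) Y (g i k) c (j - k).

(* [Y(a, x1), Y(b, x2)] c *)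
Definition commut (a b c : A) : fseries2 A :=
  fun i j => Y a (Y b c j) i - Y b (Y a c i) j.

Definition half_commutator (a b c : A) : Prop :=
  commut a b c =2 Sing2 (app2 (fsub (Y a b)) c).

End FormalSeries.

(* Main.v *)
(* Put [a_l b] = \sum_n (a_n b) l^n / n!, where a_n b is the coefficient of
   x^(-n-1) in Y(a, x)b. The half commutator formula becomes
   [a_l [b_m c]] - [b_m [a_l c]] = [[a_l b]_(l+m) c], and the hypotheses on Y
   give [a_l Db] = (D + l)[a_l b], [Da_l b] = -l [a_l b] and
   [a_l b] = -[b_(-l-D) a]. By skew-symmetry of [a_l b], exchanging a and b just
   changes the sign of both sides; applying skew-symmetry to all three terms,
   the formula for (a, c, b) at (l, m) is the one for (a, b, c) at
   (l, -l-m-D), with D acting last. Comparing coefficients turns these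
   substitutions into identities between binomial coefficients. *)
Require Import Defs.
From HB Require Import structures.
From mathcomp Require Import all_boot all_order all_algebra.
From mathcomp Require Import boolp classical_sets functions fsbigop reals.
From mathcomp Require Import complex.
From mathcomp Require Import ring zify.

Set Implicit Arguments.
Unset Strict Implicit.
Unset Printing Implicit Defensive.

Import GRing.Theory Num.Theory.
Local Open Scope ring_scope.

(** * Finite sums and binomial identities *)

Lemma sum_ord_vanish (V : nmodType) (u : nat -> V) (N M : nat) :
  (N <= M)%N -> (forall j, (N <= j)%N -> (j < M)%N -> u j = 0) ->
  \sum_(j < M) u j = \sum_(j < N) u j.
Proof.
move=> leNM u0; rewrite -(subnKC leNM) big_split_ord /= [X in _ + X]big1 ?addr0 //.
by move=> j _; rewrite u0 ?leq_addr // -ltn_subRL ltn_ord.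
Qed.

(** Since the terms from index [N] on vanish, dropping the [i] leading zeros and shifting may keep
    the same upper bound [N]. *)
Lemma sum_ord_shift (V : nmodType) (u : nat -> V) (i N M : nat) :
  (N <= M)%N -> (forall j, (j < i)%N -> u j = 0) ->
  (forall j, (N <= j)%N -> u j = 0) ->
  \sum_(j < M) u j = \sum_(r < N) u (i + r)%N.
Proof.
move=> leNM ui0 uN0; rewrite (sum_ord_vanish leNM) => [|j /uN0 //].
rewrite -(sum_ord_vanish (leq_addl i N)) => [|j /uN0 //].
rewrite big_split_ord /= big1 ?add0r //.
by move=> j _; rewrite ui0.
Qed.

Lemma fsbig_nat_ord (V : nmodType) (u : nat -> V) (N : nat) :
  (forall j, (N <= j)%N -> u j = 0) ->
  \sum_(k \in [set: nat]%classic) u k = \sum_(k < N) u k.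
Proof.
move=> u0; rewrite fsbig_ord; apply/esym/fsbig_widen => //= j [_ /= /negP].
by rewrite -leqNgt => /u0.
Qed.

Lemma fsbig_int_nat (V : nmodType) (u : int -> V) :
  (forall j, u (Negz j) = 0) ->
  \sum_(k \in [set: int]%classic) u k = \sum_(k \in [set: nat]%classic) u k%:Z.
Proof.
move=> u0; rewrite -(@fsbig_image _ _ _ _ _ setT Posz) => [|i j _ _ [] //].
apply/esym/fsbig_widen => // -[j|j] [_ /= nj]; last exact: u0.
by case: nj; exists j.
Qed.

(** Both sides are the coefficient of x^m in (1-x)^s (1-x)^(-n-1). For n < s <= m+n this is a
    polynomial of degree below m, and the right-hand binomial vanishes too. *)
Lemma sum_sign_bin_bin (R : comNzRingType) (s m n : nat) : (s <= m + n)%N ->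
  \sum_(k < m.+1) (-1) ^+ k * ('C(s, k) * 'C(m + n - k, n))%:R
    = 'C(m + n - s, m)%:R :> R.
Proof.
elim: s m => [|s IHs] m les.
  rewrite big_ord_recl big1 => [|k _]; last by rewrite bin0n mul0n mulr0.
  by rewrite bin0 !subn0 mul1n expr0 mul1r addr0 -(bin_sub (leq_addl m n)) addnK.
case: m les => [|m] les.
  by rewrite big_ord1 !bin0 !add0n subn0 binn expr0 mul1r.
have lesn : (s <= m + n)%N by lia.
have -> : (m.+1 + n - s.+1 = m + n - s)%N by lia.
have := IHs m.+1 ltac:(lia).
have -> : (m.+1 + n - s = (m + n - s).+1)%N by lia.
rewrite binS natrD -(IHs m lesn) => /(canLR (addrK _)) <-.
rewrite [LHS]big_ord_recl [in X in _ = X - _]big_ord_recl !bin0 -addrA.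
rewrite -sumrB; congr (_ + _); apply: eq_bigr => k _; rewrite lift0 binS addSn subSS mulnDl natrD exprS.
by rewrite mulrDr mulN1r !mulNr.
Qed.

Lemma sum_sign_bin (R : comNzRingType) (e m : nat) : (e <= m)%N ->
  \sum_(d < m.+1) (-1) ^+ d * 'C(e, d)%:R = (e == 0%N)%:R :> R.
Proof.
move=> lem; transitivity ((1 - 1) ^+ e : R); last by rewrite subrr expr0n.
rewrite exprDn.
transitivity (\sum_(d < e.+1) (-1) ^+ d * 'C(e, d)%:R : R).
  apply: (@sum_ord_vanish R (fun d => (-1) ^+ d * 'C(e, d)%:R)) => // d lted _.
  by rewrite bin_small // mulr0.
by apply: eq_bigr => d _; rewrite expr1n mul1r mulr_natr.
Qed.

(** Both sides equal (x+y+z)! / (x! y! z!). *)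
Lemma mul_bin_trinomial x y z :
  ('C(x + y, x) * 'C(x + y + z, x + y) = 'C(x + y + z, x) * 'C(y + z, y))%N.
Proof.
have B u v : ('C(u + v, u) * (u`! * v`!) = (u + v)`!)%N.
  by have := bin_fact (leq_addr v u); rewrite addKn.
have gt0 : (0 < x`! * (y`! * z`!))%N by rewrite !muln_gt0 !fact_gt0.
apply/eqP; rewrite -(eqn_pmul2r gt0); apply/eqP.
transitivity (x + y + z)`!; last by rewrite -addnA -B -(B y z); lia.
by rewrite -(B (x + y)%N z) -(B x y); lia.
Qed.

Lemma mul_bin_add q e d :
  ('C(q + d, q) * 'C(q + e, q + d) = 'C(q + e, q) * 'C(e, d))%N.
Proof.
case: (leqP d e) => [led|lted].
  by rewrite -{1 2}(subnKC led) addnA mul_bin_trinomial -addnA !subnKC.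
by rewrite !(@bin_small _ (_ + _)) ?(@bin_small e) ?muln0 // ltn_add2l.
Qed.

(** * Bracket calculus: sesquilinearity, skew-symmetry and the Jacobi identity *)

Section HalfBracket.
Variables (R : comNzRingType) (V : lmodType R) (D : {linear V -> V}).
Variable p : nat -> V -> V -> V.
Hypothesis p_linear : forall n a, linear (p n a).
Hypothesis p_linearl : forall n b, linear ((p n)^~ b).
Hypothesis p_local : forall a b, exists N, forall n, (N <= n)%N -> p n a b = 0.
Hypothesis D_p0 : forall a b, p 0 a (D b) = D (p 0 a b).
Hypothesis D_pS : forall m a b, p m.+1 a (D b) = D (p m.+1 a b) + p m a b.
Hypothesis p_skew : forall a b m N, (forall q, (N <= q)%N -> p q b a = 0) ->
  p m a b = - \sum_(j < N)
    ((-1) ^+ (m + j) * 'C(m + j, m)%:R) *: iter j D (p (m + j) b a).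

HB.instance Definition _ n a :=
  GRing.isLinear.Build R V V _ (p n a) (p_linear n a).

(** Swapped arguments, so that linearity in the first argument of [p] can be registered as an
    instance. *)
Let pl n (b a : V) := p n a b.
HB.instance Definition _ n b :=
  GRing.isLinear.Build R V V _ (pl n b) (p_linearl n b).

Lemma iterD_linear j : linear (iter j D).
Proof. by elim: j => [//|j IH] k u v /=; rewrite IH linearP. Qed.
HB.instance Definition _ j :=
  GRing.isLinear.Build R V V _ (iter j D) (iterD_linear j).

Lemma p_localU m b (c : nat -> V) : exists N, forall k, (k <= m)%N ->
  forall n, (N <= n)%N -> p n b (c k) = 0.
Proof.
elim: m => [|m [N HN]].
  have [N HN] := p_local b (c 0%N).
  by exists N => k; rewrite leqn0 => /eqP ->.
have [M HM] := p_local b (c m.+1).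
exists (maxn N M) => k; rewrite leq_eqVlt ltnS => /orP[/eqP->|km] n;
  rewrite geq_max => /andP[leN leM]; [exact: HM|exact: HN].
Qed.

(** Coefficient of l^m in [a_l D^j b] = (D + l)^j [a_l b]. The truncated [j - i] is harmless: the
    binomial vanishes for i > j. *)
Lemma p_iterD m a j b : p m a (iter j D b)
  = \sum_(i < m.+1) 'C(j, i)%:R *: iter (j - i) D (p (m - i) a b).
Proof.
elim: j m => [|j IH] m.
  rewrite big_ord_recl big1 => [|i _]; last by rewrite bin0n scale0r.
  by rewrite addr0 bin0 scale1r !subn0.
have DS i q : 'C(j, i)%:R *: iter (j.+1 - i) D (p q a b)
            = D ('C(j, i)%:R *: iter (j - i) D (p q a b)).
  case: (leqP i j) => [leij|ltji]; first by rewrite subSn // linearZ.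
  by rewrite bin_small // !scale0r linear0.
case: m => [|m] /=.
  by rewrite D_p0 IH !big_ord1 !bin0 !subn0 !scale1r.
rewrite D_pS !IH linear_sum [RHS]big_ord_recl [in X in X + _]big_ord_recl.
rewrite -addrA -big_split /=.
congr (_ + _); first by rewrite -DS !bin0.
apply: eq_bigr => i _; rewrite -DS /bump leq0n !add1n binS natrD scalerDl.
by rewrite !subSS.
Qed.

(** Skew-symmetry gives [Da_l b] = -[b_s Da] with s = -l-D, and [b_s Da] = (D + s)[b_s a] = -l
    [b_s a]. On coefficients the terms in D cancel by telescoping. *)
Lemma pD0 a b : p 0 (D a) b = 0.
Proof.
have [N HN] := p_local b a.
have HN' q : (N.+1 <= q)%N -> p q b (D a) = 0.
  by case: q => // q leq; rewrite D_pS !HN ?linear0 ?addr0 //; lia.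
rewrite (p_skew 0 HN').
(* The index is shifted by one so that [h 0] is zero; the other end vanishes by locality. *)
pose h j : V := if j is i.+1 then (-1) ^+ i *: iter j D (p i b a) else 0.
rewrite (eq_bigr (fun j : 'I_N.+1 => h j.+1 - h j)) => [|j _].
  rewrite -(big_mkord xpredT (fun j => h j.+1 - h j)) telescope_sumr //= HN //.
  by rewrite -iterS (linear0 (iter N.+1 D)) scaler0 subr0 oppr0.
rewrite add0n bin0 mulr1; case: (nat_of_ord j) => [|i] /=.
  by rewrite D_p0 subr0.
rewrite D_pS -!iterS (linearD (iter i.+1 D)) scalerDr.
rewrite [iter i.+2 D _]iterSr [in X in _ + X]exprS mulN1r scaleNr.
by [].
Qed.

Lemma pDS m a b : p m.+1 (D a) b = - p m a b.
Proof.
have [N HN] := p_local b a.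
have HN' q : (N.+1 <= q)%N -> p q b (D a) = 0.
  by case: q => // q leq; rewrite D_pS !HN ?linear0 ?addr0 //; lia.
have HNS q : (N.+1 <= q)%N -> p q b a = 0 by move=> leq; rewrite HN // ltnW.
apply/eqP; rewrite -subr_eq0 opprK (p_skew _ HN') (p_skew _ HNS) -opprD oppr_eq0.
rewrite -big_split /=.
(* Telescoping term: [h 0] vanishes because 'C(m, m+1) = 0, and [h N.+1] by locality. *)
pose h j := ((-1) ^+ (m + j) * 'C(m + j, m.+1)%:R) *: iter j D (p (m + j) b a).
rewrite (eq_bigr (fun j : 'I_N.+1 => h j.+1 - h j)) => [|j _].
  rewrite -(big_mkord xpredT (fun j => h j.+1 - h j)) telescope_sumr // /h.
  rewrite HN; last by lia.
  by rewrite (linear0 (iter N.+1 D)) scaler0 sub0r addn0 bin_small // mulr0 scale0r oppr0.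
rewrite D_pS (linearD (iter j D)) scalerDr /h [iter j.+1 D _]iterSr.
rewrite addnS -addSn -addrA; congr (_ + _).
rewrite -scalerDl -scaleNr addSn binS natrD exprS; congr (_ *: _).
by ring.
Qed.

Lemma p_iterDl n j a b : p n (iter j D a) b
  = if (j <= n)%N then (-1) ^+ j *: p (n - j) a b else 0.
Proof.
elim: j n => [|j IH] n; first by rewrite scale1r subn0.
case: n => [|n] /=; first exact: pD0.
rewrite pDS IH ltnS subSS; case: ifP => _; last by rewrite oppr0.
by rewrite exprS mulN1r scaleNr.
Qed.

(** In [[b_(-l-D) a]_s c] the inner D acts as -s, so [[a_l b]_s c] = -[[b_(s-l) a]_s c]; this is the
    coefficient of l^k s^(L-k). *)
Lemma pp_skew L k a b c : (k <= L)%N -> p (L - k) (p k a b) c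
  = - \sum_(s < L.+1) ((-1) ^+ k * 'C(s, k)%:R) *: p (L - s) (p s b a) c.
Proof.
move=> lekL.
have [N HN] := p_local b a.
pose N' := (N + L.+1)%N.
have HN' q : (N' <= q)%N -> p q b a = 0 by move=> leq; rewrite HN //; lia.
rewrite (p_skew _ HN') -/(pl _ _ _) linearN linear_sum /=; congr (- _).
(* Extension by zero beyond L: it reconciles the range of the skew-symmetry sum with s <= L. *)
pose u s : V :=
  if (s <= L)%N then ((-1) ^+ k * 'C(s, k)%:R) *: p (L - s) (p s b a) c else 0.
transitivity (\sum_(s < N') u s); last first.
  rewrite (@sum_ord_vanish _ u L.+1) ?leq_addl // => [|j + _]; last first.
    by rewrite /u ltnNge => /negbTE ->.
  by apply: eq_bigr => s _; rewrite /u -ltnS ltn_ord.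
rewrite -(@sum_ord_vanish _ u N' (k + N')) ?leq_addl // => [|j lej _]; last first.
  by rewrite /u; case: ifP => // _; rewrite HN' // -/(pl _ _ _) linear0 scaler0.
rewrite [RHS]big_split_ord /= [X in _ = X + _]big1 ?add0r => [|j _]; last first.
  by rewrite /u bin_small // mulr0 scale0r if_same.
apply: eq_bigr => j _; rewrite -/(pl _ _ _) linearZ /= /pl p_iterDl /u.
have -> : (j <= L - k)%N = (k + j <= L)%N by lia.
case: ifP => _; last by rewrite scaler0.
rewrite scalerA subnDA; congr (_ *: _).
rewrite mulrAC exprD -[(-1) ^+ k * _ * _]mulrA -exprD addnn.
by rewrite -(signr_odd _ j.*2) odd_double mulr1.
Qed.

(** Coefficient of l^m t^n in [a_l [b_t c]] - [b_t [a_l c]] = [[a_l b]_(l+t) c], the Jacobi identity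
    of a Lie conformal algebra. *)
Definition half_bracket a b c := forall m n,
  p m a (p n b c) - p n b (p m a c)
  = \sum_(k < m.+1) 'C(m + n - k, n)%:R *: p (m + n - k) (p k a b) c.

(** Skew-symmetry turns [[a_l b]_(l+t) c] into -[[b_t a]_(l+t) c]; on coefficients the sum over k
    collapses by [sum_sign_bin_bin]. *)
Lemma half_bracketC a b c : half_bracket a b c -> half_bracket b a c.
Proof.
move=> H n m; rewrite -opprB H.
under eq_bigr => k _.
  rewrite pp_skew; last by have := ltn_ord k; lia.
  rewrite scalerN scaler_sumr.
  over.
rewrite sumrN opprK exchange_big /=.
under eq_bigr => s _.
  under eq_bigr => k _ do rewrite scalerA mulrCA -natrM mulnC.
  rewrite -scaler_suml sum_sign_bin_bin; last by rewrite -ltnS.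
  over.
(* The terms with s > n vanish, since then m + n - s < m. *)
have -> : (m + n).+1 = (n.+1 + m)%N by lia.
rewrite (addnC n m) big_split_ord /= [X in _ + X]big1 ?addr0 // => s _ /=.
by rewrite bin_small ?scale0r //; have := ltn_ord s; lia.
Qed.

(* Solves the half commutator formula for the right-hand side: in generating
   function notation, [[a_l b]_s c] = [a_l, b_(s - l)] c. *)
Lemma half_bracket_inv a b c : half_bracket a b c -> forall m q,
  p q (p m a b) c
  = \sum_(k < m.+1) ((-1) ^+ (m - k) * 'C(q + (m - k), q)%:R) *:
      (p k a (p (q + (m - k)) b c) - p (q + (m - k)) b (p k a c)).
Proof.
(* In the fixed total degree q + m, the hypothesis expresses the commutators through the [P l] by a
   triangular binomial matrix, to be inverted. *)
move=> H m q; pose P l := p (q + m - l) (p l a b) c.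
have E (k : 'I_m.+1) :
  p k a (p (q + (m - k)) b c) - p (q + (m - k)) b (p k a c)
  = \sum_(l < m.+1) 'C(q + (m - l), q + (m - k))%:R *: P l.
  have lekm : (k <= m)%N by rewrite -ltnS.
  rewrite H (_ : k + _ = q + m)%N; last by lia.
  rewrite [RHS](_ : _ = \sum_(l < m.+1) 'C(q + m - l, q + (m - k))%:R *: P l).
    rewrite -(@sum_ord_vanish _
       (fun l => 'C(q + m - l, q + (m - k))%:R *: P l) k.+1 m.+1) // => l ltkl lelm.
    by rewrite bin_small ?scale0r //; lia.
  by apply: eq_bigr => l _; rewrite addnBA // -ltnS.
under eq_bigr => k _ do rewrite E scaler_sumr.
rewrite exchange_big /=.
under eq_bigr => l _.
  under eq_bigr => k _ do rewrite scalerA -mulrA -natrM.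
  rewrite -scaler_suml.
  over.
(* Once 'C(q + (m - l), q) is factored out, the alternating sum is (1 - 1)^(m-l), so only l = m
   survives. *)
have S (l : 'I_m.+1) :
  \sum_(k < m.+1) (-1) ^+ (m - k) *
    ('C(q + (m - k), q) * 'C(q + (m - l), q + (m - k)))%:R
  = 'C(q + (m - l), q)%:R * (m - l == 0)%N%:R :> R.
  rewrite -(sum_sign_bin R (leq_subr l m)) mulr_sumr (reindex_inj rev_ord_inj) /=.
  apply: eq_bigr => k _; rewrite subSS subKn; last by rewrite -ltnS.
  by rewrite mul_bin_add natrM mulrCA.
under eq_bigr => l _ do rewrite S.
rewrite big_ord_recr /= big1 => [|l _]; last first.
  by rewrite subn_eq0 leqNgt ltn_ord mulr0 scale0r.
by rewrite subnn eqxx addn0 binn mulr1 scale1r add0r /P addnK.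
Qed.

(** With s = -l-t-D and D acting last, [a_l [c_t b]] = -[a_l [b_s c]], [c_t [a_l b]] = -[a_l
    [b_s c]] + [b_s [a_l c]] and [[a_l c]_(l+t) b] = -[b_s [a_l c]]. *)
Lemma half_bracket_swap23 a b c : half_bracket a b c -> half_bracket a c b.
Proof.
move=> H m n.
have [N1 HN1] := p_local b c.
have [N2 HN2] := p_localU m b (fun k => p k a c).
have [N3 HN3] := p_local (p m a b) c.
pose N := (N1 + N2 + N3)%N.
(* Coefficient of l^(m-k) t^n D^r in (-l-t-D)^(n+m-k+r). *)
pose e k r : R := (-1) ^+ (n + (m - k + r)) *
  ('C(n + (m - k + r), n) * 'C(m - k + r, m - k))%:R.
pose A k r := p k a (p (n + (m - k + r)) b c).
pose B k r := p (n + (m - k + r)) b (p k a c).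
have E1 : p m a (p n c b)
    = - \sum_(k < m.+1) \sum_(r < N) e k r *: iter r D (A k r).
  have HN q : (N <= q)%N -> p q b c = 0 by move=> leq; apply: HN1; lia.
  rewrite (p_skew _ HN) linearN linear_sum; congr (- _) => /=.
  under eq_bigr => j _ do rewrite linearZ /= p_iterD scaler_sumr.
  (* Of the j factors D + l, m - k contribute l and the remaining r = j - (m - k) contribute D. *)
  rewrite exchange_big (reindex_inj rev_ord_inj) /=; apply: eq_bigr => k _.
  have lekm : (k <= m)%N by rewrite -ltnS.
  rewrite subSS subKn //.
  rewrite (@sum_ord_shift _ (fun j => ((-1) ^+ (n + j) * 'C(n + j, n)%:R) *:
    ('C(j, m - k)%:R *: iter (j - (m - k)) D (p k a (p (n + j) b c)))) (m - k) N).
  - by apply: eq_bigr => r _; rewrite scalerA -mulrA -natrM addKn.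
  - by [].
  - by move=> j ltj; rewrite (bin_small ltj) scale0r scaler0.
  - move=> j leNj; rewrite HN; last by lia.
    by rewrite (linear0 (p k a)) (linear0 (iter (j - (m - k)) D)) !scaler0.
have E2 : p n c (p m a b)
    = - \sum_(k < m.+1) \sum_(r < N) e k r *: iter r D (A k r - B k r).
  have HN q : (N <= q)%N -> p q (p m a b) c = 0 by move=> leq; apply: HN3; lia.
  rewrite (p_skew _ HN); congr (- _); rewrite [RHS]exchange_big /=.
  apply: eq_bigr => r _; rewrite (half_bracket_inv H) linear_sum scaler_sumr /=.
  apply: eq_bigr => k _; rewrite (linearZZ (iter r D)) /= scalerA.
  have -> : (n + r + (m - k) = n + (m - k + r))%N by lia.
  congr (_ *: _); rewrite /e.
  rewrite mulrACA -exprD -natrM addnAC -addnA; congr (_ * _%:R).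
  (* Both binomial products are the trinomial coefficient of n, r and m - k. *)
  have := mul_bin_trinomial n r (m - k).
  rewrite -addnA [(r + _)%N]addnC => ->; congr (_ * _)%N.
  by rewrite -(bin_sub (leq_addl _ r)) addnK.
have E3 : \sum_(k < m.+1) 'C(m + n - k, n)%:R *: p (m + n - k) (p k a c) b
    = - \sum_(k < m.+1) \sum_(r < N) e k r *: iter r D (B k r).
  rewrite -sumrN; apply: eq_bigr => k _.
  have lekm : (k <= m)%N by rewrite -ltnS.
  have HN q : (N <= q)%N -> p q b (p k a c) = 0.
    by move=> leq; apply: HN2 => //; lia.
  rewrite (p_skew _ HN) scalerN scaler_sumr; congr (- _); apply: eq_bigr => r _.
  have -> : (m + n - k = n + (m - k))%N by lia.
  by rewrite scalerA mulrCA -natrM mul_bin_trinomial -addnA.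
rewrite E1 E2 E3 opprK addrC -sumrB -sumrN; apply: eq_bigr => k _.
rewrite -sumrB -sumrN; apply: eq_bigr => r _.
by rewrite (linearB (iter r D)) /= scalerBr addrAC subrr add0r.
Qed.
End HalfBracket.

(** * From the coefficients of Y to the bracket *)

Section Modes.
Variables (F : numFieldType) (A : lmodType F).
Variables (D : {linear A -> A}) (Y : A -> A -> fseries A).
Hypothesis Y_linear : linear Y.
Hypothesis Ya_linear : forall a : A, linear (Y a).
Hypothesis Y_polar : forall a b : A, polar (Y a b).
Hypothesis Y_deriv : forall (a b : A) (n : int),
  D (Y a b n) - Y a (D b) n = fderiv (Y a b) n.
Hypothesis Y_skew : forall a b : A, Y a b =1 Sing (fexp D (fopp (Y b a))).

(* a_n b / n!, the coefficient of l^n in the bracket [a_l b] *)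
Definition dmode n a b : A := (n`!%:R : F)^-1 *: Y a b (- n.+1%:Z).

Lemma factr_neq0 n : n`!%:R != 0 :> F.
Proof. by rewrite pnatr_eq0 -lt0n fact_gt0. Qed.

Lemma Y_dmode n a b : Y a b (- n.+1%:Z) = n`!%:R *: dmode n a b.
Proof. by rewrite scalerA divff ?factr_neq0 // scale1r. Qed.

Lemma YP a n : linear (fun b => Y a b n).
Proof. by move=> k u v; rewrite (congr1 (@^~ n) (Ya_linear a k u v)). Qed.

Lemma YPl b n : linear (fun a => Y a b n).
Proof. by move=> k u v; rewrite (congr1 (fun f => f b n) (Y_linear k u v)). Qed.

Lemma dmode_linear n a : linear (dmode n a).
Proof.
by move=> k u v; rewrite /dmode YP scalerDr !scalerA [_^-1 * k]mulrC.
Qed.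

Lemma dmode_linearl n b : linear ((dmode n)^~ b).
Proof.
by move=> k u v; rewrite /dmode YPl scalerDr !scalerA [_^-1 * k]mulrC.
Qed.

Lemma Y_bound a b : exists N, forall n, (N <= n)%N -> Y a b (- n.+1%:Z) = 0.
Proof.
have [_ [N HN]] := Y_polar a b; exists `|N|%N => n leNn; apply: HN; lia.
Qed.

Lemma dmode_local a b : exists N, forall n, (N <= n)%N -> dmode n a b = 0.
Proof.
by have [N HN] := Y_bound a b; exists N => n /HN; rewrite /dmode => ->; rewrite scaler0.
Qed.

Lemma dmode_D0 a b : dmode 0 a (D b) = D (dmode 0 a b).
Proof.
rewrite /dmode linearZ; congr (_ *: _); apply/eqP.
(* A derivative has no x^(-1) term: the factor n + 1 is zero at n = -1. *)
by rewrite eq_sym -subr_eq0 Y_deriv /fderiv addNr mulr0z.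
Qed.

Lemma dmode_DS m a b : dmode m.+1 a (D b) = D (dmode m.+1 a b) + dmode m a b.
Proof.
have := Y_deriv a b (- m.+2%:Z).
rewrite /fderiv (_ : - m.+2%:Z + 1 = - m.+1%:Z); last by lia.
rewrite !Y_dmode; move: (dmode _ _ _) (dmode _ _ _) (dmode _ _ _) => u v w.
rewrite mulrNz -pmulrn -scaler_nat scalerA -natrM -factS linearZ /= -scalerBr.
rewrite -scalerN => /(scalerI (factr_neq0 _)) /eqP; rewrite subr_eq => /eqP ->.
by rewrite addrAC addNr add0r.
Qed.

(** In the coefficient of x^(-m-1), D^k/k! meets the mode m + k, and (m+k)!/(m! k!) is the binomial.
    The overall minus comes from (-1)^(-(m+k+1)). *)
Lemma dmode_skew a b m N : (forall q, (N <= q)%N -> dmode q b a = 0) ->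
  dmode m a b = - \sum_(j < N)
    ((-1) ^+ (m + j) * 'C(m + j, m)%:R) *: iter j D (dmode (m + j) b a).
Proof.
move=> HN; rewrite {1}/dmode Y_skew /Sing.
rewrite (_ : - m.+1%:Z < 0 = true); last by lia.
rewrite /fexp /fopp.
have E k : (k`!%:R : F)^-1 *:
    iter k D ((-1) ^ (- m.+1%:Z - k%:Z) *: Y b a (- m.+1%:Z - k%:Z))
   = - (((-1) ^+ (m + k) * m`!%:R * 'C(m + k, m)%:R) *: iter k D (dmode (m + k) b a)).
  have -> : - m.+1%:Z - k%:Z = - (m + k).+1%:Z by lia.
  rewrite Y_dmode scalerA (linearZZ (iter k D)) /= scalerA -scaleNr; congr (_ *: _).
  rewrite -exprz_inv invrN1 -exprnP exprS mulN1r mulNr mulrN; congr (- _).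
  rewrite -(bin_fact (leq_addr k m)) addKn !natrM.
  by field; exact: factr_neq0.
rewrite (eq_fsbigr _ _ (fun k _ => E k)) (@fsbig_nat_ord _ _ N) => [|j leNj].
  rewrite sumrN scalerN scaler_sumr; congr (- _); apply: eq_bigr => j _.
  by rewrite scalerA; congr (_ *: _); field; exact: factr_neq0.
rewrite HN; last by lia.
by rewrite (linear0 (iter j D)) scaler0 oppr0.
Qed.

(** Upper negation of a binomial coefficient. *)
Lemma bin_binz m l : (l <= m)%N ->
  (-1) ^+ l * binz F (- (m - l).+1%:Z) l = 'C(m, l)%:R.
Proof.
move=> lelm; rewrite /binz mulrA; apply: (mulIf (factr_neq0 l)).
rewrite divfK ?factr_neq0 // -natrM bin_ffact.
rewrite ffact_prod natr_prod -[X in (-1) ^+ X](card_ord l) -prodr_const -big_split.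
rewrite (reindex_inj rev_ord_inj) /=; apply: eq_bigr => i _.
rewrite mulN1r -rmorphN /= pmulrn; congr (_ *~ _).
by have := ltn_ord i; lia.
Qed.

Lemma Y0 a n : Y a 0 n = 0.
Proof. by have /= := YP a n (-1) 0 0; rewrite !scaleN1r !addNr. Qed.

Lemma Y0l b n : Y 0 b n = 0.
Proof. by have /= := YPl b n (-1) 0 0; rewrite !scaleN1r !addNr. Qed.

Lemma YZ k a b n : Y a (k *: b) n = k *: Y a b n.
Proof. by have /= := YP a n k b 0; rewrite Y0 !addr0. Qed.

Lemma YZl k a b n : Y (k *: a) b n = k *: Y a b n.
Proof. by have /= := YPl b n k a 0; rewrite Y0l !addr0. Qed.

Lemma commut_dmode a b c m n : commut Y a b c (- m.+1%:Z) (- n.+1%:Z)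
  = (m`!%:R * n`!%:R : F) *:
      (dmode m a (dmode n b c) - dmode n b (dmode m a c)).
Proof.
rewrite /commut [Y b c _]Y_dmode [Y a c _]Y_dmode 2!YZ 2!Y_dmode.
move: (dmode m a (dmode n b c)) (dmode n b (dmode m a c)) => u v.
by rewrite !scalerA scalerBr [n`!%:R * _]mulrC.
Qed.

Lemma app2_dmode a b c m n :
  app2 Y (fsub (Y a b)) c (- m.+1%:Z) (- n.+1%:Z)
  = (m`!%:R * n`!%:R : F) *: \sum_(k < m.+1)
      'C(m + n - k, n)%:R *: dmode (m + n - k) (dmode k a b) c.
Proof.
rewrite /app2 fsbig_int_nat => [|j]; last exact: Y0l.
(* A power x2^j beside x1^(-m-1) comes from exponent j-m-1, which is nonnegative for j > m, where
   [Y a b] vanishes. *)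
rewrite (@fsbig_nat_ord _ _ m.+1) => [|j ltmj]; last first.
  by rewrite /fsub (Y_polar a b).1 ?scaler0 ?Y0l //; lia.
rewrite (reindex_inj rev_ord_inj) scaler_sumr; apply: eq_bigr => k _ /=.
have lekm : (k <= m)%N by rewrite -ltnS.
rewrite subSS (_ : - m.+1%:Z + (m - k)%N%:Z = - (m - (m - k)).+1%:Z); last by lia.
rewrite bin_binz ?leq_subr // subKn // bin_sub // YZl.
rewrite (_ : - n.+1%:Z - (m - k)%N%:Z = - (m + n - k).+1%:Z); last by lia.
rewrite [Y a b _]Y_dmode YZl Y_dmode; move: (dmode (m + n - k) _ _) => u.
rewrite !scalerA; congr (_ *: _).
(* Factorials match: 'C(m, k) k! (m+n-k)! = m! n! 'C(m+n-k, n). *)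
rewrite -(bin_fact lekm) -(bin_fact (_ : n <= m + n - k)%N); last by lia.
rewrite (_ : m + n - k - n = m - k)%N; last by lia.
by rewrite !natrM; ring.
Qed.

(** At doubly negative exponents both sides carry the nonzero factor m! n!. At the others [Sing2] is
    zero, and so is the commutator because Y has polar values. *)
Lemma half_commutator_dmode a b c :
  half_commutator Y a b c <-> half_bracket dmode a b c.
Proof.
have neq0 m n : m`!%:R * n`!%:R != 0 :> F by rewrite mulf_neq0 ?factr_neq0.
have neg k : (- k.+1%:Z < 0) = true by lia.
split=> [H m n|H i j].
  apply: (scalerI (neq0 m n)); rewrite -commut_dmode -app2_dmode H /Sing2.
  by rewrite !neg.
rewrite /Sing2; case: (ltrP i 0) => [ilt0|ige0] /=; last first.
  by rewrite /commut !(Y_polar a _).1 // Y0 subrr.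
case: (ltrP j 0) => [jlt0|jge0] /=; last first.
  by rewrite /commut !(Y_polar b _).1 // Y0 subrr.
have -> : i = - (`|i|%N.-1).+1%:Z by lia.
have -> : j = - (`|j|%N.-1).+1%:Z by lia.
by rewrite commut_dmode app2_dmode H.
Qed.
End Modes.

(** * Reduction to adjacent transpositions and conclusion *)

Lemma perm_eq3_ind (T : eqType) (P : T -> T -> T -> Prop) :
  (forall x y z, P x y z -> P y x z) -> (forall x y z, P x y z -> P x z y) ->
  forall x y z, P x y z ->
  forall x' y' z', perm_eq [:: x'; y'; z'] [:: x; y; z] -> P x' y' z'.
Proof.
move=> P12 P23.
(* With the first entry fixed, at most the last two are exchanged; the other cases first bring the
   right entry to the front. *)
have fix1 x y z x' y' z' : P x y z -> x' = x ->
    perm_eq [:: x'; y'; z'] [:: x; y; z] -> P x' y' z'.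
  move=> Pxyz ->; rewrite perm_cons => pe.
  have := perm_mem pe y'; rewrite !inE eqxx => /esym /orP[] /eqP Ey.
    move: pe; rewrite Ey perm_cons => /perm_mem /(_ z').
    by rewrite !inE eqxx => /esym/eqP ->.
  move: pe; rewrite Ey -[[:: y; z]]/([:: y] ++ [:: z]) perm_sym perm_catC.
  rewrite perm_cons => /perm_mem /(_ y).
  by rewrite !inE eqxx => /esym/eqP <-; apply: P23.
move=> x y z Pxyz x' y' z' pe.
have := perm_mem pe x'; rewrite !inE eqxx => /esym /or3P[] /eqP Ex.
- exact: fix1 pe.
- apply: (fix1 y x z) => //; first exact: P12.
  by rewrite (permPl pe) -[[:: x; y; z]]/([:: x; y] ++ [:: z])
             (perm_cat2r _ [:: x; y] [:: y; x]) (perm_catC [:: x] [:: y]).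
- apply: (fix1 z x y) => //; first exact/P12/P23.
  by rewrite (permPl pe) (perm_catC [:: x; y] [:: z]).
Qed.

Theorem proposition2p9 (R : realType) (A : lmodType R[i])
    (D : {linear A -> A}) (Y : A -> A -> fseries A)
    (Y_linear : linear Y)
    (Ya_linear : forall a : A, linear (Y a))
    (Y_polar : forall a b : A, polar (Y a b))
    (Y_deriv : forall (a b : A) (n : int),
       D (Y a b n) - Y a (D b) n = fderiv (Y a b) n)
    (Y_skew : forall a b : A, Y a b =1 Sing (fexp D (fopp (Y b a))))
    (a b c : A) :
  half_commutator Y a b c ->
  forall a' b' c' : A, perm_eq [:: a'; b'; c'] [:: a; b; c] ->
  half_commutator Y a' b' c'.
Proof.
pose E := half_commutator_dmode Y_linear Ya_linear Y_polar.
pose lin := dmode_linear Ya_linear; pose linl := dmode_linearl Y_linear.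
pose loc := dmode_local Y_polar; pose D0 := dmode_D0 Y_deriv.
pose DS := dmode_DS Y_deriv; pose skew := dmode_skew Y_skew.
move: a b c; apply: perm_eq3_ind => x y z /E H; apply/E.
  exact: (half_bracketC linl loc D0 DS skew).
exact: (half_bracket_swap23 lin loc D0 DS skew).
Qed.
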